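(* Let $X$ be a finite subset of the unit sphere $\Omega\subset\mathbb{C}^d$, any two distinct elements of which span distinct lines, with degree set $A$. Suppose $X$ is a $t$-design ($t\ge 1$), and let $F(x)\in\mathbb{R}[x]$ be a polynomial such that (a) $\alpha F(\alpha)\ge 0$ for every $\alpha\in A$, and $F(1)>0$; (b) if $F(x)=\sum_r c_r h_r(x)$ is the expansion of $F$ in the polynomials $h_0,h_1,h_2,\dots$, then $c_0>0$ and $c_r\le 0$ for all $r\ge t$. Then $$|X|\ \ge\ \frac{F(1)}{c_0}.$$
   Context: $\Omega$ is the unit sphere in $\mathbb{C}^d$, with the unitarily invariant probability measure $\omega$. The degree set of $X\subseteq\Omega$ is $A=\{|x^*y|^2 : x,y\in X,\ x\ne y\}$. $\mathrm{Hom}(k,l)$ is the space of polynomials in $z_1,\dots,z_d,\bar z_1,\dots,\bar z_d$ that are homogeneous of degree $k$ in the $z_i$ and homogeneous of degree $l$ in the $\bar z_i$, viewed as functions on $\mathbb{C}^d$. A finite $X\subseteq\Omega$ is a $t$-design if $\frac1{|X|}\sum_{z\in X} f(z)=\int_\Omega f\,d\omega$ for every $f\in\mathrm{Hom}(t,t)$. The polynomials $h_k$ (of degree $k$) are $$h_k(x)=\frac{d+2k}{(d-1)!}\sum_{r=0}^{k}(-1)^r\frac{(d+2k-r-1)!}{r!\,(k-r+1)!\,(k-r)!}\,x^{k-r}.$$ For example, $h_0(x)=d$ and $h_1(x)=\frac{d(d+2)}{2}((d+1)x-2)$. *)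

(* Defs.v *)
From HB Require Import structures.
From mathcomp Require Import all_boot all_order all_algebra.
From mathcomp Require Import finmap complex.
From mathcomp Require Import all_classical all_reals all_analysis.
(* Not imported: the notations of mpoly clash with those of the analysis
   library. *)
From mathcomp Require mpoly.

Set Implicit Arguments.
Unset Strict Implicit.
Unset Printing Implicit Defensive.

Import Order.TTheory GRing.Theory Num.Theory.
Import numFieldNormedType.Exports.

Local Open Scope classical_set_scope.
Local Open Scope sesquilinear_scope.
Local Open Scope complex_scope.
Local Open Scope ring_scope.

Section Defs.
Variables (R : realType) (d : nat).

Local Notation C := R[i].
Local Notation Cd := 'cV[C]_d.

(* x^* y *)
Definition herm (x y : Cd) : C := (x ^t* *m y) 0 0.

Definition sphere : set Cd := [set z | herm z z = 1].

(* C^d with its Borel sigma-algebra.  The topology is carried by the regular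
   algebra C^o, hence the 'cV[C^o]_d. *)
Definition borelCd := g_sigma_algebraType (@open 'cV[C^o]_d).

(* omega is a probability on the ambient C^d that is carried by the sphere,
   i.e. a Borel probability measure on the sphere; the last clause determines
   it uniquely. *)
Definition unitarily_invariant_on_sphere (omega : probability borelCd R) :=
  omega (sphere : set borelCd) = 1%E /\
  forall U : 'M[C]_d, U \is unitarymx ->
    forall B : set borelCd, measurable B ->
      omega ((fun z : borelCd => (U *m (z : Cd)) : borelCd) @^-1` B) = omega B.

(* The library integral is real-valued: integrate real and imaginary parts. *)
Definition sphere_integral (omega : probability borelCd R) (f : Cd -> C) : C :=
  Complex (\int[omega]_(z in (sphere : set borelCd)) complex.Re (f z))
          (\int[omega]_(z in (sphere : set borelCd)) complex.Im (f z)).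

(* In a polynomial in d + d variables, the first d variables stand for
   z_1, ..., z_d and the last d for their conjugates. *)
Definition bihomogeneous (k l : nat) (p : mpoly.mpoly (d + d) C) : bool :=
  all (fun m : mpoly.multinom (d + d) =>
         (\sum_(i < d) mpoly.fun_of_multinom m (lshift d i) == k)%N &&
         (\sum_(i < d) mpoly.fun_of_multinom m (rshift d i) == l)%N)
      (mpoly.msupp p).

Definition conj_eval (p : mpoly.mpoly (d + d) C) (z : Cd) : C :=
  mpoly.meval (fun i : 'I_(d + d) =>
    match fintype.split i with inl j => z j 0 | inr j => (z j 0)^* end) p.

Definition Hom (k l : nat) : set (Cd -> C) :=
  [set conj_eval p | p in [set p | bihomogeneous k l p]].

Definition is_design (omega : probability borelCd R) (t : nat)
    (X : {fset Cd}) : Prop :=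
  forall f, Hom t t f ->
    (#|` X|%:R)^-1 * \sum_(z <- X) f z = sphere_integral omega f.

Definition degree_set (X : {fset Cd}) : set R :=
  [set a | exists x y,
     [/\ x \in X, y \in X, x != y & a%:C = `|herm x y| ^+ 2]].

(* The truncated subtractions are exact since 0 < d and r <= k. *)
Definition hpoly (k : nat) : {poly R} :=
  ((d + 2 * k)%:R / (d.-1)`!%:R) *:
  \sum_(r < k.+1)
    ((-1) ^+ r * ((d + 2 * k - r - 1)`!)%:R
       / (r`! * (k - r + 1)`! * (k - r)`!)%:R) *: 'X^(k - r).

End Defs.

Arguments sphere : clear implicits.
Arguments hpoly : clear implicits.

(* Main.v *)
Require Import Defs.
From mathcomp Require Import all_boot all_order all_algebra zify ring.
From mathcomp Require mpoly ssrcomplements.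

(* Sum a F(a), with a = |x^* y|^2, over all pairs x, y in X.  By (a) the sum is
   at least its diagonal part |X| F(1).  Expanding F in the h_r, it is the sum
   of the c_r S_r, where S_r is the sum of a h_r(a) over all pairs:
   - S_r >= 0 for all r, since (x^* y) h_r(|x^* y|^2) is, up to a positive
     factor, the Gram kernel, for the Fischer product, of the zonal harmonic
     polynomials of bidegree (r + 1, r), and multiplying by (y^* x) keeps it
     positive semidefinite;
   - S_0 = |X|^2 and S_r = 0 for 0 < r < t.  By unitary invariance the design
     gives sum_x |x^* y|^2k = mu_k |y|^2k for k <= t, and applying the Laplacian
     in y to both sides gives k mu_(k-1) = (d + k - 1) mu_k, hence the values of
     the moments up to degree t; inserted in S_r they give a telescoping sum. *)

Set Implicit Arguments.
Unset Strict Implicit.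
Unset Printing Implicit Defensive.

Import Order.TTheory GRing.Theory Num.Theory.

Local Open Scope ring_scope.

Module Fischer.
Import mpoly ssrcomplements.

(** * The Fischer product on polynomials *)

Section FischerProduct.
Variables (C : numClosedFieldType) (n : nat).
Implicit Types (p q : {mpoly C[n]}) (m : 'X_{1..n}) (i : 'I_n).

Definition mfact m : nat := \prod_(i < n) (m i)`!.

(** Linear in the first argument, conjugate-linear in the second. Monomials are orthogonal, and the
    weight m! makes multiplication by a variable adjoint to differentiation. *)
Definition fischer p q : C :=
  \sum_(m <- msupp p) (mfact m)%:R * p@_m * (q@_m)^*.

(** An index set that does not depend on p, so that products of several polynomials can be compared
    term by term. *)
Lemma fischerwE k p q : (msize p <= k)%N ->
  fischer p q = \sum_(m : 'X_{1..n < k}) (mfact m)%:R * p@_m * (q@_m)^*.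
Proof.
move=> le_pk; set I : subFinType _ := 'X_{1..n < k}.
rewrite /fischer (big_mksub I) ?msupp_uniq //=; last first.
  by move=> x /msize_mdeg_lt /leq_trans; apply.
by rewrite big_rmcond //= => j /memN_msupp_eq0 ->; rewrite mulr0 mul0r.
Qed.

Lemma fischerDl p p' q : fischer (p + p') q = fischer p q + fischer p' q.
Proof.
pose k := maxn (msize (p + p')) (maxn (msize p) (msize p')).
rewrite !(@fischerwE k) ?leq_max ?leqnn ?orbT // -big_split.
by apply: eq_bigr => m _ /=; rewrite mcoeffD; ring.
Qed.

Lemma fischerZl c p q : fischer (c *: p) q = c * fischer p q.
Proof.
pose k := maxn (msize (c *: p)) (msize p).
rewrite !(@fischerwE k) ?leq_max ?leqnn ?orbT // mulr_sumr.
by apply: eq_bigr => m _ /=; rewrite mcoeffZ; ring.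
Qed.

Lemma fischer0l q : fischer 0 q = 0.
Proof. by rewrite /fischer msupp0 big_nil. Qed.

Lemma fischerC p q : fischer q p = (fischer p q)^*.
Proof.
pose k := maxn (msize p) (msize q).
rewrite !(@fischerwE k) ?leq_max ?leqnn ?orbT // rmorph_sum.
by apply: eq_bigr => m _ /=; rewrite !rmorphM /= conjCK rmorph_nat; ring.
Qed.

Lemma fischer_suml (I : Type) (r : seq I) (P : pred I)
    (F : I -> {mpoly C[n]}) q :
  fischer (\sum_(i <- r | P i) F i) q = \sum_(i <- r | P i) fischer (F i) q.
Proof.
exact: (big_morph (fischer^~ q) (fun p p' => fischerDl p p' q) (fischer0l q)).
Qed.

Lemma fischerDr p q q' : fischer p (q + q') = fischer p q + fischer p q'.
Proof. by rewrite fischerC fischerDl rmorphD /= -!fischerC. Qed.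

Lemma fischerZr c p q : fischer p (c *: q) = c^* * fischer p q.
Proof. by rewrite fischerC fischerZl rmorphM /= -!fischerC. Qed.

Lemma fischer0r p : fischer p 0 = 0.
Proof. by rewrite fischerC fischer0l rmorph0. Qed.

Lemma fischer_sumr (I : Type) (r : seq I) (P : pred I)
    (F : I -> {mpoly C[n]}) p :
  fischer p (\sum_(i <- r | P i) F i) = \sum_(i <- r | P i) fischer p (F i).
Proof. exact: (big_morph (fischer p) (fischerDr p) (fischer0r p)). Qed.

Lemma fischer_ge0 p : 0 <= fischer p p.
Proof.
by apply: sumr_ge0 => m _; rewrite -mulrA mulr_ge0 ?ler0n ?mul_conjC_ge0.
Qed.

Lemma fischerXl m q : fischer 'X_[m] q = (mfact m)%:R * (q@_m)^*.
Proof. by rewrite /fischer msuppX big_seq1 mcoeffX eqxx mulr1. Qed.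

Lemma mfactS m i : mfact (m + U_(i)) = (mfact m * (m i).+1)%N.
Proof.
rewrite /mfact (bigD1 i) //= [in RHS](bigD1 i) //= mnmDE mnm1E eqxx addn1 factS.
rewrite -mulnA mulnC; congr (_ * _)%N; congr (_ * _)%N.
by apply: eq_bigr => j ji; rewrite mnmDE mnm1E eq_sym (negPf ji) addn0.
Qed.

(** By linearity p is a monomial 'X_[m]; the factor m_i + 1 produced by the derivative is the
    quotient of the weights of m + U_(i) and m. *)
Lemma fischer_adjoint i p q : fischer ('X_i * p) q = fischer p q^`M(i).
Proof.
rewrite [p]mpolyE mulr_sumr !fischer_suml; apply: eq_bigr => m _.
rewrite -scalerAr !fischerZl -mpolyXD !fischerXl mcoeff_deriv addmC mfactS.
by rewrite rmorphMn natrM /= -[_ *+ (m i).+1]mulr_natr; ring.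
Qed.

Lemma mderiv_exp i p k : (p ^+ k)^`M(i) = k%:R * p^`M(i) * p ^+ k.-1.
Proof.
elim: k => [|k IHk]; first by rewrite expr0 mderivC !mul0r.
rewrite exprS mderivM IHk /= -addn1 natrD.
case: k {IHk} => [|k] /=; rewrite ?expr0 ?exprS; ring.
Qed.

End FischerProduct.

(** * Polynomials in z and its conjugate, and their Laplacian *)

Section Zonal.
Variables (C : numClosedFieldType) (d : nat).
Implicit Types (x y : 'cV[C]_d) (p q : {mpoly C[d + d]}) (i : 'I_d).

Definition hdot x y : C := \sum_i (x i 0)^* * y i 0.

(* [hvar i] and [avar i] stand for z_i and its conjugate, as independent
   variables; h is for holomorphic and a for antiholomorphic. *)
Definition hvar i : {mpoly C[d + d]} := 'X_(lshift d i).
Definition avar i : {mpoly C[d + d]} := 'X_(rshift d i).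
(** As functions of z, [hlin x], [alin x] and [sqnorm] are x^* z, its conjugate z^* x, and |z|^2. *)
Definition hlin x := \sum_i (x i 0)^*%:MP * hvar i.
Definition alin x := \sum_i (x i 0)%:MP * avar i.
Definition sqnorm : {mpoly C[d + d]} := \sum_i hvar i * avar i.

Definition hderiv i p := p^`M(lshift d i).
Definition aderiv i p := p^`M(rshift d i).
(** The complex Laplacian, a quarter of the real one. *)
Definition laplacian p := \sum_i hderiv i (aderiv i p).

Lemma hdotC x y : hdot y x = (hdot x y)^*.
Proof.
by rewrite rmorph_sum; apply: eq_bigr => i _; rewrite rmorphM /= conjCK mulrC.
Qed.

Lemma fischer_laplacian p q :
  fischer (sqnorm * p) q = fischer p (laplacian q).
Proof.
rewrite /sqnorm mulr_suml fischer_suml /laplacian fischer_sumr.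
apply: eq_bigr => i _.
by rewrite [hvar i * _]mulrC -mulrA !fischer_adjoint.
Qed.

Lemma mderiv_var (i j : 'I_(d + d)) :
  ('X_j : {mpoly C[d + d]})^`M(i) = ((i == j)%:R)%:MP.
Proof.
rewrite mderivX mnm1E eq_sym; case: eqP => [->|_]; last first.
  by rewrite scale0r mpolyC0.
by rewrite -{1}[U_(j)%MM]add0m addmK mpolyX0 scale1r mpolyC1.
Qed.

Lemma hderiv_hvar i j : hderiv i (hvar j) = ((i == j)%:R)%:MP.
Proof. by rewrite /hderiv mderiv_var (inj_eq (@lshift_inj _ _)). Qed.

Lemma hderiv_avar i j : hderiv i (avar j) = 0.
Proof. by rewrite /hderiv mderiv_var eq_lrshift mpolyC0. Qed.

Lemma aderiv_avar i j : aderiv i (avar j) = ((i == j)%:R)%:MP.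
Proof. by rewrite /aderiv mderiv_var (inj_eq (@rshift_inj _ _)). Qed.

Lemma aderiv_hvar i j : aderiv i (hvar j) = 0.
Proof. by rewrite /aderiv mderiv_var eq_rlshift mpolyC0. Qed.

Lemma hderivM i p q : hderiv i (p * q) = hderiv i p * q + p * hderiv i q.
Proof. exact: mderivM. Qed.

Lemma aderivM i p q : aderiv i (p * q) = aderiv i p * q + p * aderiv i q.
Proof. exact: mderivM. Qed.

Lemma hderiv_hlin i x : hderiv i (hlin x) = ((x i 0)^*)%:MP.
Proof.
rewrite /hderiv /hlin raddf_sum (bigD1 i) //= big1 => [|j ji]; last first.
  rewrite -/(hderiv _ _) hderivM hderiv_hvar eq_sym (negPf ji) mpolyC0 mulr0.
  by rewrite /hderiv mderivC mul0r addr0.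
rewrite -/(hderiv _ _) hderivM hderiv_hvar eqxx mpolyC1 mulr1.
by rewrite /hderiv mderivC mul0r addr0 add0r.
Qed.

Lemma aderiv_hlin i x : aderiv i (hlin x) = 0.
Proof.
rewrite /aderiv /hlin raddf_sum big1 // => j _.
by rewrite /= mderivM mderivC -/(aderiv _ _) aderiv_hvar mulr0 mul0r addr0.
Qed.

Lemma aderiv_alin i x : aderiv i (alin x) = (x i 0)%:MP.
Proof.
rewrite /aderiv /alin raddf_sum (bigD1 i) //= big1 => [|j ji]; last first.
  rewrite -/(aderiv _ _) aderivM aderiv_avar eq_sym (negPf ji) mpolyC0 mulr0.
  by rewrite /aderiv mderivC mul0r addr0.
rewrite -/(aderiv _ _) aderivM aderiv_avar eqxx mpolyC1 mulr1.
by rewrite /aderiv mderivC mul0r addr0 add0r.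
Qed.

Lemma hderiv_alin i x : hderiv i (alin x) = 0.
Proof.
rewrite /hderiv /alin raddf_sum big1 // => j _.
by rewrite /= mderivM mderivC -/(hderiv _ _) hderiv_avar mulr0 mul0r addr0.
Qed.

Lemma hderiv_sqnorm i : hderiv i sqnorm = avar i.
Proof.
rewrite /hderiv /sqnorm raddf_sum (bigD1 i) //= big1 => [|j ji]; last first.
  rewrite -/(hderiv _ _) hderivM hderiv_hvar hderiv_avar eq_sym (negPf ji).
  by rewrite mpolyC0 mulr0 mul0r addr0.
rewrite -/(hderiv _ _) hderivM hderiv_hvar hderiv_avar eqxx mpolyC1.
by rewrite mulr0 mul1r !addr0.
Qed.

Lemma aderiv_sqnorm i : aderiv i sqnorm = hvar i.
Proof.
rewrite /aderiv /sqnorm raddf_sum (bigD1 i) //= big1 => [|j ji]; last first.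
  rewrite -/(aderiv _ _) aderivM aderiv_avar aderiv_hvar eq_sym (negPf ji).
  by rewrite mpolyC0 mulr0 mul0r addr0.
rewrite -/(aderiv _ _) aderivM aderiv_avar aderiv_hvar eqxx mpolyC1.
by rewrite mulr1 mul0r add0r addr0.
Qed.

Lemma hderiv_exp i p k : hderiv i (p ^+ k) = k%:R * hderiv i p * p ^+ k.-1.
Proof. exact: mderiv_exp. Qed.

Lemma aderiv_exp i p k : aderiv i (p ^+ k) = k%:R * aderiv i p * p ^+ k.-1.
Proof. exact: mderiv_exp. Qed.

Lemma hderivD i p q : hderiv i (p + q) = hderiv i p + hderiv i q.
Proof. exact: mderivD. Qed.

Lemma hderiv_nat i k : hderiv i k%:R = 0.
Proof. by rewrite /hderiv -mpolyC_nat mderivC. Qed.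

Lemma hderiv_C i c : hderiv i c%:MP = 0.
Proof. exact: mderivC. Qed.

(** The building blocks of zonal polynomials with pole x, of bidegree (j + p, j + q). *)
Definition hmono x (j p q : nat) := sqnorm ^+ j * (hlin x ^+ p * alin x ^+ q).

Lemma laplacian_hmono x (j p q : nat) :
  laplacian (hmono x j p q) =
    (j * (j.-1 + d + p + q))%:R * hmono x j.-1 p q
      + (p * q)%:R * (hdot x x)%:MP * hmono x j p.-1 q.-1.
Proof.
pose N := sqnorm; pose L := hlin x; pose M := alin x.
(* The product rule for a single i, sorted by which of the factors N, L, M the two derivatives
   hit. *)
have termE i : hderiv i (aderiv i (hmono x j p q)) =
    j%:R * (N ^+ j.-1 * L ^+ p * M ^+ q)
    + j%:R * (j.-1)%:R * (N ^+ j.-1.-1 * L ^+ p * M ^+ q) * (hvar i * avar i)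
    + j%:R * p%:R * (N ^+ j.-1 * L ^+ p.-1 * M ^+ q) * ((x i 0)^*%:MP * hvar i)
    + j%:R * q%:R * (N ^+ j.-1 * L ^+ p * M ^+ q.-1) * ((x i 0)%:MP * avar i)
    + p%:R * q%:R * (N ^+ j * L ^+ p.-1 * M ^+ q.-1)
      * ((x i 0)^*%:MP * (x i 0)%:MP).
  rewrite /hmono !aderivM !aderiv_exp aderiv_sqnorm aderiv_hlin aderiv_alin.
  rewrite !(hderivM, hderivD) !hderiv_exp hderiv_sqnorm hderiv_hlin.
  rewrite hderiv_alin hderiv_hvar.
  rewrite !hderiv_nat !hderiv_C eqxx mpolyC1 -/N -/L -/M; ring.
rewrite /laplacian (eq_bigr _ (fun i _ => termE i)) !big_split /=.
rewrite -!mulr_sumr -/sqnorm -/(hlin x) -/(alin x) sumr_const card_ord.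
rewrite -/N -/L -/M.
have -> : \sum_i ((x i 0)^*%:MP_[d + d] * (x i 0)%:MP) = (hdot x x)%:MP.
  by rewrite /hdot raddf_sum; apply: eq_bigr => i _; rewrite /= mpolyCM.
(* Truncated predecessors are harmless: where the exponent is 0, so is the coefficient in front. *)
have eN : (j.-1)%:R * (N ^+ j.-1.-1) * N = (j.-1)%:R * N ^+ j.-1.
  by case: (j.-1) => [|k]; rewrite ?mul0r //= -mulrA -exprSr.
have eL : p%:R * (L ^+ p.-1) * L = p%:R * L ^+ p.
  by case: (p) => [|k]; rewrite ?mul0r //= -mulrA -exprSr.
have eM : q%:R * (M ^+ q.-1) * M = q%:R * M ^+ q.
  by case: (q) => [|k]; rewrite ?mul0r //= -mulrA -exprSr.
rewrite /hmono -/N -/L -/M !natrM !natrD -[_ *+ d]mulr_natr.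
ring: eN eL eM.
Qed.

Lemma laplacianD p q : laplacian (p + q) = laplacian p + laplacian q.
Proof.
rewrite /laplacian -big_split; apply: eq_bigr => i _.
by rewrite /hderiv /aderiv !mderivD.
Qed.

Lemma laplacianZ c p : laplacian (c *: p) = c *: laplacian p.
Proof.
rewrite /laplacian scaler_sumr; apply: eq_bigr => i _.
by rewrite /hderiv /aderiv !mderivZ.
Qed.

Lemma laplacian0 : laplacian 0 = 0.
Proof. by have := laplacianZ 0 0; rewrite !scale0r. Qed.

Lemma hmono0 x (p q : nat) : hmono x 0 p q = hlin x ^+ p * alin x ^+ q.
Proof. by rewrite /hmono expr0 mul1r. Qed.

Lemma fischer11 : fischer (1 : {mpoly C[d + d]}) 1 = 1.
Proof.
rewrite -{1}mpolyX0 fischerXl mcoeff1 eqxx rmorph1 mulr1.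
by rewrite /mfact big1 // => i _; rewrite mnmE.
Qed.

(** Multiplication by [hlin y] is adjoint to a derivative in direction y, which sees only the powers
    of [hlin x] and lowers their exponent. *)
Lemma fischer_hlin y x p (a b : nat) :
  fischer (hlin y * p) (hmono x 0 a b) =
    a%:R * hdot y x * fischer p (hmono x 0 a.-1 b).
Proof.
rewrite /hlin mulr_suml fischer_suml /hdot mulr_sumr mulr_suml.
apply: eq_bigr => i _; rewrite -mulrA mul_mpolyC fischerZl fischer_adjoint.
rewrite -/(hderiv _ _) !hmono0 hderivM !hderiv_exp hderiv_hlin hderiv_alin.
rewrite mulr0 mul0r mulr0 addr0 -!mulrA -mpolyC_nat mul_mpolyC fischerZr.
by rewrite mul_mpolyC fischerZr conjCK rmorph_nat; ring.
Qed.

Lemma fischer_alin y x p (a b : nat) :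
  fischer (alin y * p) (hmono x 0 a b) =
    b%:R * hdot x y * fischer p (hmono x 0 a b.-1).
Proof.
rewrite /alin mulr_suml fischer_suml /hdot mulr_sumr mulr_suml.
apply: eq_bigr => i _; rewrite -mulrA mul_mpolyC fischerZl fischer_adjoint.
rewrite -/(aderiv _ _) !hmono0 aderivM !aderiv_exp aderiv_hlin aderiv_alin.
rewrite mulr0 mul0r mul0r add0r.
have -> : hlin x ^+ a * (b%:R * (x i 0)%:MP * alin x ^+ b.-1) =
   b%:R%:MP * ((x i 0)%:MP * (hlin x ^+ a * alin x ^+ b.-1)).
  by rewrite mpolyC_nat; ring.
by rewrite mul_mpolyC fischerZr mul_mpolyC fischerZr rmorph_nat; ring.
Qed.

(** Reproducing property: pairing with [hlin x ^+ a * alin x ^+ b] is, up to the factor a! b!,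
    evaluation at x. The adjoints strip off the factors of the left-hand polynomial one by one;
    [sqnorm] becomes a Laplacian. *)
Lemma fischer_hmono y x (j p q : nat) :
  fischer (hmono y j p q) (hmono x 0 (j + p) (j + q)) =
    ((j + p)`! * (j + q)`!)%:R *
      (hdot x x ^+ j * (hdot y x ^+ p * hdot x y ^+ q)).
Proof.
elim: j => [|j IHj].
  rewrite !add0n [hmono y _ _ _]hmono0 mul1r.
  elim: p => [|p IHp].
    elim: q => [|q IHq]; first by rewrite hmono0 !expr0 !mulr1 fischer11.
    move: IHq; rewrite !mul1r !fact0 !mul1n => IHq.
    by rewrite exprS fischer_alin IHq factS natrM exprS; ring.
  by rewrite exprS -mulrA fischer_hlin IHp factS !natrM exprS; ring.
rewrite !addSn [hmono y _ _ _]/hmono exprS -mulrA -/(hmono y j p q).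
rewrite fischer_laplacian laplacian_hmono mul0n mul0r add0r /=.
rewrite -mpolyC_nat -mulrA mul_mpolyC fischerZr mul_mpolyC fischerZr IHj.
by rewrite !factS !natrM rmorphM !rmorph_nat -hdotC exprS; ring.
Qed.

(** * Zonal harmonics of bidegree (k + 1, k) and positivity of their kernel *)

Section Harmonic.
Variables (k : nat) (a : nat -> C).
Hypothesis a_rec : forall j, (j < k)%N ->
  a j.+1 * (j.+1 * (d + 2 * k - j - 1))%:R
    + a j * ((k - j).+1 * (k - j))%:R = 0.

(** The recursion [a_rec] expresses that the Laplacian of this sum vanishes coefficient by
    coefficient when x is a unit vector. *)
Definition zonal x : {mpoly C[d + d]} :=
  \sum_(j < k.+1) a j *: hmono x j (k - j).+1 (k - j).

Lemma laplacian_zonal x : (0 < d)%N -> hdot x x = 1 -> laplacian (zonal x) = 0.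
Proof.
move=> d_gt0 x1; rewrite /zonal (big_morph _ laplacianD laplacian0).
under eq_bigr do rewrite laplacianZ laplacian_hmono x1 mpolyC1 mulr1 scalerDr.
(* The part that lowers the power of [sqnorm] loses its term j = 0, the other part its term j = k.
   After a shift by one the two run over the same monomials, with [a_rec] as coefficient. *)
rewrite big_split /= big_ord_recl /= !mul0r scaler0 add0r.
rewrite [X in _ + X]big_ord_recr /= subnn muln0 mul0r scaler0 addr0 -big_split.
rewrite big1 // => j _ /=; rewrite /bump /= !add1n.
have jk := ltn_ord j.
have ekj : (k - j = (k - j.+1).+1)%N by rewrite subnSK.
rewrite ekj -!mpolyC_nat !mul_mpolyC !scalerA -scalerDl /=.
have -> : (j + d + (k - j.+1).+1 + (k - j.+1) = d + 2 * k - j - 1)%N by lia.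
by have := a_rec jk; rewrite ekj => ->; rewrite scale0r.
Qed.

(* All but the first term of [zonal x] are multiples of [sqnorm], hence
   orthogonal to the harmonic polynomial [zonal y]. *)
Lemma fischer_zonal y x : (0 < d)%N -> hdot y y = 1 -> hdot x x = 1 ->
  fischer (zonal y) (zonal x) =
    ((a 0)^* * (k.+1`! * k`!)%:R) *
      \sum_(j < k.+1) a j * (hdot y x ^+ (k - j).+1 * hdot x y ^+ (k - j)).
Proof.
move=> d_gt0 y1 x1; rewrite {2}/zonal big_ord_recl fischerDr fischerZr subn0.
rewrite [X in _ + X](_ : _ = 0) ?addr0; last first.
  pose Q := \sum_(i < k) a (lift ord0 i) *:
    hmono x i (k - lift ord0 i).+1 (k - lift ord0 i).
  rewrite (_ : \sum_(i < k) _ = sqnorm * Q); last first.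
    rewrite mulr_sumr; apply: eq_bigr => i _.
    by rewrite -scalerAr /hmono lift0 [sqnorm ^+ _.+1]exprS -mulrA.
  by rewrite fischerC fischer_laplacian laplacian_zonal // fischer0r rmorph0.
rewrite -mulrA; congr (_ * _).
rewrite /zonal fischer_suml mulr_sumr; apply: eq_bigr => j _.
have jk : (j <= k)%N by rewrite -ltnS.
have := fischer_hmono y x j (k - j).+1 (k - j).
by rewrite fischerZl addnS (subnKC jk) => ->; rewrite x1 expr1n mul1r; ring.
Qed.

(** The kernel of [fischer_zonal] has one factor [hdot y x] too many. Multiplying it by [hdot x y],
    the sum over i of y_i conj(x_i), leaves powers of [|hdot y x| ^+ 2] and splits the double sum
    into d Fischer squares. *)
Lemma zonal_psd (s : seq 'cV[C]_d) : (0 < d)%N -> 0 < a 0 ->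
    (forall x, x \in s -> hdot x x = 1) ->
  0 <= \sum_(y <- s) \sum_(x <- s) \sum_(j < k.+1)
         a j * (`|hdot y x| ^+ 2) ^+ (k - j).+1.
Proof.
move=> d_gt0 a0_gt0 s1.
have w_gt0 : 0 < (a 0)^* * (k.+1`! * k`!)%:R.
  by rewrite geC0_conj ?ltW // mulr_gt0 // ltr0n muln_gt0 !fact_gt0.
rewrite -(pmulr_rge0 _ w_gt0).
rewrite [leRHS](_ : _ = \sum_i fischer (\sum_(y <- s) y i 0 *: zonal y)
                                    (\sum_(x <- s) x i 0 *: zonal x)).
  by apply: sumr_ge0 => i _; apply: fischer_ge0.
under [RHS]eq_bigr => i _.
  rewrite fischer_suml; under eq_bigr do rewrite fischer_sumr.
  over.
rewrite [RHS]exchange_big mulr_sumr; apply: eq_big_seq => y ys.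
rewrite [RHS]exchange_big mulr_sumr; apply: eq_big_seq => x xs /=.
under [RHS]eq_bigr do
  rewrite fischerZl fischerZr fischer_zonal ?s1 //
    [y _ _ * _]mulrA [y _ _ * _]mulrC.
rewrite -mulr_suml -/(hdot x y) mulrCA; congr (_ * _).
rewrite mulr_sumr; apply: eq_bigr => j _.
by rewrite normCK -hdotC exprMn [hdot x y ^+ _ in LHS]exprS; ring.
Qed.

End Harmonic.

(** * Evaluation at points, and bidegrees *)

(** The substitution made by [conj_eval], over a general field; the two evaluations are
    convertible. *)
Definition conj_point x (i : 'I_(d + d)) : C :=
  match fintype.split i with inl j => x j 0 | inr j => (x j 0)^* end.

Lemma meval_hvar x i : (hvar i).@[conj_point x] = x i 0.
Proof. by rewrite mevalXU /conj_point (unsplitK (inl i)). Qed.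

Lemma meval_avar x i : (avar i).@[conj_point x] = (x i 0)^*.
Proof. by rewrite mevalXU /conj_point (unsplitK (inr i)). Qed.

Lemma meval_hmono y x (j p q : nat) :
  (hmono y j p q).@[conj_point x] =
    hdot x x ^+ j * (hdot y x ^+ p * hdot x y ^+ q).
Proof.
have eN : sqnorm.@[conj_point x] = hdot x x.
  rewrite /sqnorm raddf_sum; apply: eq_bigr => i _.
  by rewrite /= mevalM meval_hvar meval_avar mulrC.
have eL : (hlin y).@[conj_point x] = hdot y x.
  rewrite /hlin raddf_sum; apply: eq_bigr => i _.
  by rewrite /= mevalM mevalC meval_hvar.
have eM : (alin y).@[conj_point x] = hdot x y.
  rewrite /alin raddf_sum; apply: eq_bigr => i _.
  by rewrite /= mevalM mevalC meval_avar mulrC.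
by rewrite /hmono !mevalM !rmorphXn /= eN eL eM.
Qed.

(** Propositional form of [bihomogeneous], suited to closure under sums and products. *)
Definition has_bidegree (a b : nat) p := forall m, m \in msupp p ->
  (\sum_(i < d) m (lshift d i) = a)%N /\ (\sum_(i < d) m (rshift d i) = b)%N.

Lemma bidegree_mul a b a' b' p q : has_bidegree a b p -> has_bidegree a' b' q ->
  has_bidegree (a + a')%N (b + b')%N (p * q).
Proof.
move=> pab qab m /msuppM_le /allpairsP[[m1 m2] /= [/pab[<- <-] /qab[<- <-] ->]].
by rewrite -!big_split; split; apply: eq_bigr => i _; rewrite mnmDE.
Qed.

Lemma bidegree_exp a b p k : has_bidegree a b p ->
  has_bidegree (a * k)%N (b * k)%N (p ^+ k).
Proof.
move=> pab; elim: k => [|k IHk]; last first.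
  by rewrite exprS !mulnS; exact: bidegree_mul.
rewrite expr0 !muln0 => m; rewrite msupp1 inE => /eqP ->.
by split; apply: big1 => i _; rewrite mnmE.
Qed.

Lemma bidegree_sum a b (F : 'I_d -> {mpoly C[d + d]}) :
  (forall i, has_bidegree a b (F i)) -> has_bidegree a b (\sum_i F i).
Proof.
move=> Fab m /msupp_sum_le /flatten_mapP[i _]; exact: Fab.
Qed.

Lemma bidegree_hvar i : has_bidegree 1 0 (hvar i).
Proof.
move=> m; rewrite msuppX inE => /eqP ->; split; last first.
  by apply: big1 => j _; rewrite mnm1E eq_lrshift.
rewrite (bigD1 i) //= mnm1E eqxx big1 // => j ji.
by rewrite mnm1E (inj_eq (@lshift_inj _ _)) eq_sym (negPf ji).
Qed.

Lemma bidegree_avar i : has_bidegree 0 1 (avar i).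
Proof.
move=> m; rewrite msuppX inE => /eqP ->; split.
  by apply: big1 => j _; rewrite mnm1E eq_rlshift.
rewrite (bigD1 i) //= mnm1E eqxx big1 // => j ji.
by rewrite mnm1E (inj_eq (@rshift_inj _ _)) eq_sym (negPf ji).
Qed.

Lemma bidegree_scale a b c p : has_bidegree a b p ->
  has_bidegree a b (c%:MP * p).
Proof. by move=> pab m; rewrite mul_mpolyC => /msuppZ_le; exact: pab. Qed.

Lemma bidegree_hmono x (j p q : nat) :
  has_bidegree (j + p)%N (j + q)%N (hmono x j p q).
Proof.
have N11 : has_bidegree 1 1 sqnorm.
  apply: bidegree_sum => i.
  apply: (@bidegree_mul 1 0 0 1); first exact: bidegree_hvar.
  exact: bidegree_avar.
have L10 : has_bidegree 1 0 (hlin x).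
  by apply: bidegree_sum => i; apply: bidegree_scale; exact: bidegree_hvar.
have M01 : has_bidegree 0 1 (alin x).
  by apply: bidegree_sum => i; apply: bidegree_scale; exact: bidegree_avar.
rewrite -[X in has_bidegree X]mul1n -[X in has_bidegree _ X]mul1n !mulnDr.
apply: bidegree_mul; first exact: bidegree_exp.
rewrite -[X in has_bidegree X]addn0 -[X in has_bidegree _ X]add0n.
by apply: (@bidegree_mul _ (0 * p) (0 * q)); exact: bidegree_exp.
Qed.

Lemma all_bidegree a b p : has_bidegree a b p ->
  all (fun m : 'X_{1..d + d} => (\sum_(i < d) m (lshift d i) == a)%N &&
                                (\sum_(i < d) m (rshift d i) == b)%N) (msupp p).
Proof. by move=> pab; apply/allP => m /pab[-> ->]; rewrite !eqxx. Qed.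

End Zonal.
End Fischer.

Import Fischer.

(** * The Hermitian form on C^d *)

Section HermitianForm.
Variables (C : numClosedFieldType) (d : nat).
Implicit Types x y v : 'cV[C]_d.

Lemma hdotDr x y v : hdot x (y + v) = hdot x y + hdot x v.
Proof.
by rewrite /hdot -big_split; apply: eq_bigr => i _; rewrite mxE mulrDr.
Qed.

Lemma hdotZr x y c : hdot x (c *: y) = c * hdot x y.
Proof.
by rewrite /hdot mulr_sumr; apply: eq_bigr => i _; rewrite mxE; ring.
Qed.

Lemma hdotDl x y v : hdot (x + y) v = hdot x v + hdot y v.
Proof. by rewrite hdotC hdotDr rmorphD /= -!hdotC. Qed.

Lemma hdotZl x y c : hdot (c *: x) y = c^* * hdot x y.
Proof. by rewrite hdotC hdotZr rmorphM /= -!hdotC. Qed.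

Lemma hdot_delta x i : hdot x (delta_mx i 0) = (x i 0)^*.
Proof.
rewrite /hdot (bigD1 i) //= big1 => [|j ji]; rewrite mxE ?eqxx ?(negPf ji) /=.
  by rewrite mulr1 addr0.
by rewrite mulr0.
Qed.

Lemma hdot_ge0 x : 0 <= hdot x x.
Proof. by apply: sumr_ge0 => i _; rewrite mulrC mul_conjC_ge0. Qed.

Lemma hdot_eq0 x : hdot x x = 0 -> x = 0.
Proof.
move=> x0; apply/matrixP => i j; rewrite ord1 mxE; apply/eqP.
have ge0 k : true -> 0 <= (x k 0)^* * x k 0 by rewrite mulrC mul_conjC_ge0.
have := psumr_eq0P ge0 x0 (isT : xpredT i); rewrite mulrC -normCK => /eqP.
by rewrite sqrf_eq0 normr_eq0.
Qed.

End HermitianForm.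

(** * The recursion between moments *)

Section Moments.
Variable C : numClosedFieldType.

(** The difference would have more roots than its degree allows. This turns identities at natural
    values of a real parameter into polynomial ones, to which formal derivatives apply. *)
Lemma poly_eq_on_nat (p q : {poly C}) :
  (forall n : nat, p.[n%:R] = q.[n%:R]) -> p = q.
Proof.
move=> pq; apply/eqP; rewrite -subr_eq0; apply/negPn/negP => pq_neq0.
pose s : seq C := [seq n%:R | n <- iota 0 (size (p - q))].
have := @max_poly_roots _ (p - q) s pq_neq0.
rewrite size_map size_iota ltnn => H; apply: notF; apply: H.
  by apply/allP => _ /mapP[n _ ->]; rewrite rootE hornerD hornerN pq subrr.
rewrite map_inj_uniq ?iota_uniq // => m n /eqP.
by rewrite eqr_nat => /eqP.
Qed.

Definition quad (a b c : C) : {poly C} := a%:P + b *: 'X + c *: 'X^2.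

Lemma quad_exp_deriv2 a b c k :
  ((quad a b c ^+ k)^`()^`()).[0] =
    k%:R * (k.-1%:R * a ^+ k.-2 * b ^+ 2 + 2 * a ^+ k.-1 * c).
Proof.
have q0 : (quad a b c).[0] = a by rewrite /quad !hornerE /=; ring.
have q1 : (quad a b c)^`().[0] = b.
  by rewrite /quad !derivE !hornerE /=; ring.
have q2 : (quad a b c)^`()^`().[0] = 2 * c.
  by rewrite /quad !derivE !hornerE /=; ring.
move: (quad a b c) q0 q1 q2 => Q q0 q1 q2.
rewrite deriv_exp derivMn derivM deriv_exp !hornerE /= hornerMn.
rewrite !hornerE /= hornerMn !hornerE /= q0 q1 q2.
rewrite -[_ *+ k]mulr_natl -[_ *+ k.-1]mulr_natl; ring.
Qed.

Variable d : nat.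
Implicit Types x y v : 'cV[C]_d.
Variables (s : seq 'cV[C]_d) (k : nat) (mu : C).
Hypothesis moment : forall y,
  \sum_(x <- s) (`|hdot x y| ^+ 2) ^+ k = mu * hdot y y ^+ k.

(* The moment identity at y + s v, differentiated twice in the real variable s
   at s = 0. *)
Lemma moment_deriv2 y v :
  \sum_(x <- s) (k%:R * (k.-1%:R * (`|hdot x y| ^+ 2) ^+ k.-2
        * (hdot x y * (hdot x v)^* + (hdot x y)^* * hdot x v) ^+ 2
      + 2 * (`|hdot x y| ^+ 2) ^+ k.-1 * `|hdot x v| ^+ 2)) =
  mu * (k%:R * (k.-1%:R * hdot y y ^+ k.-2 * (hdot y v + (hdot y v)^*) ^+ 2
      + 2 * hdot y y ^+ k.-1 * hdot v v)).
Proof.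
pose Q x := quad (`|hdot x y| ^+ 2)
  (hdot x y * (hdot x v)^* + (hdot x y)^* * hdot x v) (`|hdot x v| ^+ 2).
pose Q0 := quad (hdot y y) (hdot y v + (hdot y v)^*) (hdot v v).
have eqQ : \sum_(x <- s) Q x ^+ k = mu *: Q0 ^+ k.
  apply: poly_eq_on_nat => n; rewrite horner_sum hornerZ horner_exp.
  have -> : Q0.[n%:R] = hdot (y + n%:R *: v) (y + n%:R *: v).
    rewrite !(hdotDl, hdotDr, hdotZl, hdotZr) rmorph_nat.
    by rewrite /Q0 /quad !hornerE /= [hdot v y]hdotC; ring.
  rewrite -moment; apply: eq_bigr => x _; rewrite horner_exp; congr (_ ^+ k).
  rewrite hdotDr hdotZr !normCK rmorphD rmorphM /= rmorph_nat.
  by rewrite /Q /quad !normCK !hornerE /=; ring.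
have := congr1 (fun p : {poly C} => p^`()^`().[0]) eqQ.
rewrite !derivZ hornerZ quad_exp_deriv2 => <-.
rewrite !raddf_sum horner_sum; apply: eq_bigr => x _.
by rewrite /= quad_exp_deriv2.
Qed.

Lemma moment_rec y : hdot y y = 1 -> (0 < k)%N ->
    (forall x, x \in s -> hdot x x = 1) ->
  k%:R * \sum_(x <- s) (`|hdot x y| ^+ 2) ^+ k.-1 = mu * (d + k.-1)%:R.
Proof.
move=> y1 k_gt0 s1.
(* Adding the second derivatives along v and 'i v cancels the pure squares and leaves the mixed
   complex derivative along v, up to the factor 4 k. *)
have dirE v : k%:R * \sum_(x <- s) (`|hdot x y| ^+ 2) ^+ k.-1 * `|hdot x v| ^+ 2
    = mu * (k.-1%:R * `|hdot y v| ^+ 2 + hdot v v).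
  have := moment_deriv2 y v; have := moment_deriv2 y ('i *: v).
  have k4_neq0 : 4 * k%:R != 0 :> C by rewrite mulf_neq0 // pnatr_eq0 // -lt0n.
  move=> eq_iv eq_v; apply: (mulfI k4_neq0).
  transitivity (mu * (k%:R * ((k.-1)%:R * hdot y y ^+ k.-2 *
        (hdot y v + (hdot y v)^*) ^+ 2 + 2 * hdot y y ^+ k.-1 * hdot v v)) +
      mu * (k%:R * ((k.-1)%:R * hdot y y ^+ k.-2 *
        (hdot y ('i *: v) + (hdot y ('i *: v))^*) ^+ 2
      + 2 * hdot y y ^+ k.-1 * hdot ('i *: v) ('i *: v)))); last first.
    rewrite y1 !expr1n !hdotZr !hdotZl rmorphM /= conjCi normCK.
    have ii := sqrCi C; ring: ii.
  rewrite -eq_v -eq_iv -big_split !mulr_sumr; apply: eq_bigr => x _ /=.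
  rewrite hdotZr normrM normCi mul1r rmorphM /= conjCi.
  set A := `|hdot x y| ^+ 2; set b := `|hdot x v| ^+ 2.
  have eA : k.-1%:R * A ^+ k.-2 * A = k.-1%:R * A ^+ k.-1.
    by case: (k.-1) => [|j]; rewrite ?mul0r //= -mulrA -exprSr.
  have ek : k%:R = k.-1%:R + 1 :> C by rewrite natr1 prednK.
  have -> : k%:R * (k.-1%:R * A ^+ k.-2 *
        (hdot x y * (hdot x v)^* + (hdot x y)^* * hdot x v) ^+ 2
        + 2 * A ^+ k.-1 * b) +
      k%:R * (k.-1%:R * A ^+ k.-2 *
        (hdot x y * (- 'i * (hdot x v)^*)
          + (hdot x y)^* * ('i * hdot x v)) ^+ 2 + 2 * A ^+ k.-1 * b) =
     4 * k%:R * (k.-1%:R * A ^+ k.-2 * A * b + A ^+ k.-1 * b).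
    by rewrite /A /b !normCK; have ii := sqrCi C; ring: ii.
  by rewrite eA [in RHS]ek; ring: ek.
(* Summing over the standard basis vectors v completes the Laplacian; since x and y are unit
   vectors, the right side becomes mu (k - 1 + d). *)
transitivity (\sum_i mu * (k.-1%:R * `|hdot y (delta_mx i 0)| ^+ 2
    + hdot (delta_mx i 0 : 'cV[C]_d) (delta_mx i 0))).
  rewrite -(eq_bigr _ (fun i _ => dirE _)) -mulr_sumr exchange_big /=.
  congr (_ * _); apply: eq_big_seq => x xs; rewrite -mulr_sumr.
  rewrite -[LHS]mulr1 -(s1 x xs); congr (_ * _); apply: eq_bigr => i _.
  by rewrite hdot_delta normCK conjCK.
rewrite -mulr_sumr big_split /= -mulr_sumr [X in _ * X + _](_ : _ = 1).
  under eq_bigr do rewrite hdot_delta mxE !eqxx conjC1.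
  by rewrite sumr_const card_ord natrD mulr1 addrC.
by rewrite -y1; apply: eq_bigr => i _; rewrite hdot_delta normCK conjCK.
Qed.

End Moments.

(** * The coefficients of the polynomials h_k *)

Section Coefficients.
Variable K : numFieldType.

(** The coefficient of x^(k - j) in h_k, over a general field because the harmonic kernel is complex
    while [hpoly] is real. *)
Definition hcoef (d k j : nat) : K :=
  (d + 2 * k)%:R / (d.-1)`!%:R *
    ((-1) ^+ j * ((d + 2 * k - j - 1)`!)%:R
       / (j`! * (k - j + 1)`! * (k - j)`!)%:R).

(** This is the recursion [a_rec]: the coefficients of h_k are those of a harmonic zonal polynomial
    of bidegree (k + 1, k). *)
Lemma hcoef_rec d k j : (0 < d)%N -> (j < k)%N ->
  hcoef d k j.+1 * (j.+1 * (d + 2 * k - j - 1))%:R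
    + hcoef d k j * ((k - j).+1 * (k - j))%:R = 0.
Proof.
move=> d_gt0 jk; rewrite /hcoef.
have -> : (d + 2 * k - j - 1 = (d + 2 * k - j.+1 - 1).+1)%N by lia.
have -> : (k - j = (k - j.+1).+1)%N by lia.
move: (d + 2 * k - j.+1 - 1)%N (k - j.+1)%N => u v.
rewrite !addn1 !factS !natrM exprS; field.
have nz1 m : 1 + m%:R != 0 :> K by rewrite nat1r pnatr_eq0.
have nz2 m : 2 + m%:R != 0 :> K by rewrite -natrD pnatr_eq0.
by rewrite !nz1 !nz2 !pnatr_eq0 -!lt0n !fact_gt0.
Qed.

Lemma hcoef0_gt0 d k : (0 < d)%N -> 0 < hcoef d k 0.
Proof.
by move=> d_gt0; rewrite /hcoef expr0 mul1r !(mulr_gt0, divr_gt0)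
  ?invr_gt0 ?ltr0n ?muln_gt0 ?fact_gt0 ?addn_gt0 ?d_gt0.
Qed.

Lemma hcoef00 d : (0 < d)%N -> hcoef d 0 0 = d%:R.
Proof.
move=> d_gt0; rewrite /hcoef expr0 muln0 addn0 !subn0 subn1 !fact0 !muln1.
by rewrite invr1 mulr1 mul1r divfK // pnatr_eq0 -lt0n fact_gt0.
Qed.

(* The sum telescopes: its partial sums, scaled by k (d + k), are
   (k - m) (d + k - m) times the last term. *)
Lemma hcoef_orthogonal d k (M : nat -> K) : (0 < d)%N -> (0 < k)%N ->
    (forall i, (i <= k)%N -> i.+1%:R * M i = (d + i)%:R * M i.+1) ->
  \sum_(j < k.+1) hcoef d k j * M (k - j).+1 = 0.
Proof.
move=> d_gt0 k_gt0 M_rec; pose b j := hcoef d k j * M (k - j).+1.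
have b_rec j : (j < k)%N ->
    b j.+1 * (j.+1 * (d + 2 * k - j - 1))%:R =
      - (b j * ((k - j) * (d + k - j))%:R).
  move=> jk; have /eqP := hcoef_rec d_gt0 jk; rewrite addr_eq0 => /eqP a_rec.
  have := M_rec (k - j)%N (leq_subr _ _).
  rewrite /b mulrAC a_rec; have -> : (k - j.+1).+1 = (k - j)%N by lia.
  rewrite -addnBA ?(ltnW jk) // => M_recj.
  transitivity (- (hcoef d k j * (k - j)%:R * ((k - j).+1%:R * M (k - j)%N))).
    by rewrite natrM; ring.
  by rewrite M_recj natrM; ring.
have partial m : (m <= k)%N ->
    (k * (d + k))%:R * (\sum_(j < m.+1) b j) = ((k - m) * (d + k - m))%:R * b m.
  elim: m => [|m IHm] mk; first by rewrite big_ord_recl big_ord0 addr0 !subn0.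
  rewrite big_ord_recr mulrDr IHm ?(ltnW mk) //=.
  have /eqP := b_rec m mk; rewrite -eqr_oppLR => /eqP b_recm.
  rewrite [_ * b m]mulrC -b_recm.
  have -> : (d + 2 * k - m - 1 = d + k - m.+1 + (k - m.+1 + m.+1))%N by lia.
  have -> : (k * (d + k) = (k - m.+1 + m.+1) * (d + k - m.+1 + m.+1))%N.
    by rewrite !subnK //; lia.
  have -> : (d + k - m.+1 = k - m.+1 + d)%N by lia.
  move: (k - m.+1)%N => v.
  rewrite !(natrM, natrD); ring.
(* At m = k the right side vanishes, while k (d + k) is nonzero. *)
have := partial k (leqnn k); rewrite subnn mul0n mul0r => /eqP.
rewrite mulf_eq0 pnatr_eq0 muln_eq0 addn_eq0.
by rewrite !eqn0Ngt k_gt0 d_gt0 => /eqP.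
Qed.

End Coefficients.

(** * Transitivity of the unitary group on the sphere, up to a phase *)

Section Unitary.
Variables (C : numClosedFieldType) (d : nat).
Local Open Scope sesquilinear_scope.
Implicit Types (x y w : 'cV[C]_d) (U : 'M[C]_d).

Lemma hdotE x y : (x ^t* *m y) 0 0 = hdot x y.
Proof. by rewrite mxE; apply: eq_bigr => i _; rewrite !mxE. Qed.

Lemma hdot_mulmx U x y : U \is unitarymx -> hdot (U *m x) (U *m y) = hdot x y.
Proof.
move=> /unitarymxP /mulmx1C UU.
by rewrite -!hdotE trmx_mul map_mxM -mulmxA [_ *m (U *m y)]mulmxA UU mul1mx.
Qed.

(** The Householder reflection along w; for w = 0 the convention 2 / 0 = 0 makes it the identity. *)
Definition reflection w : 'M[C]_d := 1%:M - (2 / hdot w w) *: (w *m w ^t*).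

Lemma reflection_mul w x :
  reflection w *m x = x - (2 / hdot w w * hdot w x) *: w.
Proof.
rewrite mulmxBl mul1mx -scalemxAl -mulmxA -scalerA; congr (_ - _ *: _).
by rewrite [_ *m x]mx11_scalar hdotE mul_mx_scalar.
Qed.

Lemma reflection_unitary w : reflection w \is unitarymx.
Proof.
set a := 2 / hdot w w.
have a_real : a^* = a.
  by rewrite geC0_conj // divr_ge0 ?hdot_ge0 ?ler0n.
have aww : a * (2 - a * hdot w w) = 0.
  rewrite /a; have [->|nz] := eqVneq (hdot w w) 0.
    by rewrite invr0 !mulr0 mul0r.
  by rewrite divfK // subrr mulr0.
rewrite /reflection -/a; clearbody a.
have reflT : (1%:M - a *: (w *m w ^t*)) ^t* = 1%:M - a *: (w *m w ^t*).
  apply/matrixP => i j; rewrite !mxE !big_ord1 !mxE.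
  by rewrite rmorphB !rmorphM /= conjCK a_real rmorph_nat eq_sym; ring.
have wwE : w *m w^t* *m (w *m w^t*) = hdot w w *: (w *m w^t*).
  rewrite -mulmxA [w^t* *m (_ *m _)]mulmxA [w^t* *m w]mx11_scalar hdotE.
  by rewrite mul_scalar_mx -scalemxAr.
apply/unitarymxP; rewrite reflT.
rewrite mulmxBl mul1mx mulmxBr mulmx1 -scalemxAl -scalemxAr wwE !scalerA.
rewrite -addrA -opprD -[RHS]subr0; congr (_ - _).
rewrite -scalerBl -scalerDl (_ : _ + _ = a * (2 - a * hdot w w)); last by ring.
by rewrite aww scale0r.
Qed.

(** The phase c makes the product of c y and x equal to [|h|], hence real, so the reflection along x
    - c y maps x to c y. A phase is harmless for moments, which see only absolute values. *)
Lemma unitary_transitive x y : hdot x x = 1 -> hdot y y = 1 ->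
  exists U : 'M[C]_d, exists c : C,
    [/\ U \is unitarymx, `|c| = 1 & U *m x = c *: y].
Proof.
move=> x1 y1.
pose h := hdot y x.
pose c := if h == 0 then 1 else h / `|h|.
have c1 : `|c| = 1.
  rewrite /c; case: eqVneq => [_|h_neq0]; first by rewrite normr1.
  by rewrite normrM normfV normr_id divff ?normr_eq0.
have ch : c^* * h = `|h|.
  rewrite /c; case: eqVneq => [->|h_neq0]; first by rewrite mulr0 normr0.
  rewrite rmorphM /= fmorphV /= conj_normC.
  by rewrite mulrAC [_^* * h]mulrC -normCK expr2 mulfK ?normr_eq0.
have hh : `|h| ^* = `|h| by rewrite conj_normC.
pose w := x - c *: y; exists (reflection w), c; split => //.
  exact: reflection_unitary.
have wx : hdot w x = 1 - `|h|.
  by rewrite /w -scaleN1r hdotDl !hdotZl rmorphN1 x1 -/h ch mulN1r.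
have ww : hdot w w = 2 * (1 - `|h|).
  rewrite {2}/w -scaleN1r hdotDr !hdotZr wx /w -scaleN1r hdotDl !hdotZl.
  rewrite rmorphN1 y1 (hdotC y x) -/h mulr1.
  have e1 : c * c^* = 1 by rewrite -normCK c1 expr1n.
  have e2 : c * h^* = `|h| by rewrite -hh -ch rmorphM /= conjCK.
  by rewrite !mulN1r mulrBr e1 e2; ring.
rewrite reflection_mul wx.
have [w0|w_neq0] := eqVneq (hdot w w) 0.
  have /eqP := hdot_eq0 w0; rewrite subr_eq0 => /eqP <-.
  by rewrite w0 invr0 mulr0 mul0r scale0r subr0.
rewrite -mulrA [_^-1 * _]mulrC mulrA -ww divff // scale1r /w opprB.
by rewrite addrC subrK.
Qed.
End Unitary.

(** * The sums S_r over a set with invariant moments *)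

Section DesignSums.
Variables (C : numClosedFieldType) (d t : nat) (s : seq 'cV[C]_d).
Hypothesis d_gt0 : (0 < d)%N.
Hypothesis s_unit : forall x, x \in s -> hdot x x = 1.

Definition moment k y : C := \sum_(x <- s) (`|hdot x y| ^+ 2) ^+ k.

Hypothesis moment_inv : forall k y y', (k <= t)%N ->
  hdot y y = 1 -> hdot y' y' = 1 -> moment k y = moment k y'.

(** Homogeneity extends the invariance from the sphere to all of C^d, where the identity can be
    differentiated. *)
Lemma moment_homogeneous k y y0 : (0 < k <= t)%N -> hdot y0 y0 = 1 ->
  moment k y = moment k y0 * hdot y y ^+ k.
Proof.
move=> /andP[k_gt0 kt] y01; have [y0E|y_neq0] := eqVneq (hdot y y) 0.
  rewrite y0E expr0n -[k == 0]negbK -lt0n k_gt0 mulr0 /moment big1 // => x _.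
  rewrite (hdot_eq0 y0E) -(scale0r 0) hdotZr mul0r normr0 !expr0n.
  by rewrite -[k == 0]negbK -lt0n k_gt0.
have [b b_ge0 b2] : exists2 b : C, 0 <= b & b ^+ 2 = hdot y y.
  by exists (sqrtC (hdot y y)); rewrite ?sqrtC_ge0 ?hdot_ge0 ?sqrtCK.
have b_neq0 : b != 0 by rewrite -sqrf_eq0 b2.
pose u := b^-1 *: y.
have yE : y = b *: u by rewrite scalerA divff // scale1r.
have u1 : hdot u u = 1.
  rewrite /u hdotZl hdotZr geC0_conj ?invr_ge0 //.
  by rewrite mulrA -expr2 exprVn b2 mulVf.
rewrite -(moment_inv kt u1 y01) /moment mulr_suml; apply: eq_bigr => x _.
rewrite {1}yE hdotZr normrM (ger0_norm b_ge0) [(_ * _) ^+ 2]exprMn b2.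
by rewrite exprMn mulrC.
Qed.

Lemma moment_step i y : (i < t)%N -> hdot y y = 1 ->
  i.+1%:R * moment i y = (d + i)%:R * moment i.+1 y.
Proof.
move=> it y1.
have H v : \sum_(x <- s) (`|hdot x v| ^+ 2) ^+ i.+1 =
    moment i.+1 y * hdot v v ^+ i.+1.
  by apply: moment_homogeneous.
by rewrite (moment_rec H y1) // mulrC.
Qed.

Definition hsum r : C := \sum_(y <- s) \sum_(x <- s)
  \sum_(j < r.+1) hcoef C d r j * (`|hdot y x| ^+ 2) ^+ (r - j).+1.

Lemma hsumE r : hsum r =
  \sum_(y <- s) \sum_(j < r.+1) hcoef C d r j * moment (r - j).+1 y.
Proof.
apply: eq_bigr => y _; rewrite exchange_big; apply: eq_bigr => j _.
rewrite mulr_sumr; apply: eq_bigr => x _.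
by rewrite hdotC norm_conjC.
Qed.

(** Here h_0 = d, and d times the first moment is the zeroth one, the number of points. *)
Lemma hsum0 : (0 < t)%N -> hsum 0 = (size s)%:R ^+ 2.
Proof.
move=> t_gt0; rewrite hsumE.
have M1 y : y \in s -> d%:R * moment 1 y = (size s)%:R.
  move=> ys; have := moment_step t_gt0 (s_unit ys); rewrite mul1r addn0 => <-.
  by rewrite /moment big_const_seq count_predT iter_addr_0.
under eq_big_seq => y ys.
  rewrite big_ord_recl big_ord0 addr0 hcoef00 // M1 //.
  over.
by rewrite /= big_const_seq count_predT iter_addr_0 expr2 mulr_natr.
Qed.

(** The sum vanishes for each y separately. It involves moments up to order r + 1, which is at most
    t. *)
Lemma hsum_eq0 r : (0 < r < t)%N -> hsum r = 0.
Proof.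
move=> /andP[r_gt0 rt]; rewrite hsumE big_seq big1 // => y ys.
apply: (@hcoef_orthogonal C d r (moment^~ y)) => // i ir.
by apply: moment_step; [exact: leq_ltn_trans rt|exact: s_unit].
Qed.

Lemma hsum_ge0 r : 0 <= hsum r.
Proof.
apply: (@zonal_psd C d r (hcoef C d r)) => //.
  by move=> j jr; exact: hcoef_rec.
exact: hcoef0_gt0.
Qed.

End DesignSums.

From mathcomp Require Import finmap complex.
From mathcomp Require Import all_classical all_reals all_analysis.
From mathcomp Require Import measurable_realfun.

Import Order.TTheory GRing.Theory Num.Theory.
Import numFieldNormedType.Exports.

Local Open Scope classical_set_scope.
Local Open Scope ring_scope.

(** * Continuity and Borel measurability on C^d *)

Section Measurability.
Variables (R : realType) (d : nat).
Local Notation C := R[i].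

Lemma herm_hdot (x y : 'cV[C]_d) : herm x y = hdot x y.
Proof. exact: hdotE. Qed.

Lemma continuous_Re : continuous (@complex.Re R : C^o -> R).
Proof.
move=> x A /nbhs_ballP [e e0 eA]; apply/(@nbhs_ballP C C^o).
exists e%:C%C; first by rewrite /= ltcR.
move=> y; rewrite -ball_normE /= => xy; apply: eA; rewrite -ball_normE /=.
by rewrite -ltcR; apply: le_lt_trans xy; rewrite -raddfB; exact: normc_ge_Re.
Qed.

Lemma continuous_linear_form (u : 'I_d -> C) :
  continuous (fun z : 'cV[C^o]_d => \sum_i u i * z i 0 : C^o).
Proof.
apply: continuous_big => [|i _ z]; first exact: add_continuous.
apply: (@continuousM C^o _ (fun=> u i) (fun z : 'cV[C^o]_d => z i 0)).
  exact: cst_continuous.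
exact: coord_continuous.
Qed.

Lemma continuous_mulmx (U : 'M[C]_d) :
  continuous (mulmx U : 'cV[C^o]_d -> 'cV[C^o]_d).
Proof.
move=> z A [P nbhsP sPA].
have FF : Filter (nbhs z) := @nbhs_filter 'cV[C^o]_d z.
(* Neighbourhoods of a matrix are given entrywise, which reduces the claim to linear forms. *)
suff : \forall z' \near z, forall i j, P i j ((U *m z') i j).
  by apply: filterS => z' Pz'; exact: sPA.
apply: (@filter_forall _ 'I_d
  (fun i z' => forall j, P i j ((U *m z') i j)) _ FF) => i.
apply: (@filter_forall _ 'I_1 (fun j z' => P i j ((U *m z') i j)) _ FF) => j.
suff : (fun z' : 'cV[C^o]_d => (U *m z') i j : C^o) @ z -->
    ((U *m z) i j : C^o).
  by apply; exact: nbhsP.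
rewrite ord1 mxE; under eq_fun do rewrite mxE.
exact: continuous_linear_form.
Qed.

Lemma measurable_continuous (f : 'cV[C^o]_d -> R) : continuous f ->
  measurable_fun [set: borelCd R d] (f : borelCd R d -> R).
Proof.
move=> /continuousP cf.
apply: (measurability (@RGenOpens.G R)); first exact: RGenOpens.measurableE.
move=> _ [_ [a [b ->]] <-]; rewrite setTI; apply: sub_sigma_algebra.
by apply: cf; exact: interval_open.
Qed.

Lemma measurable_mulmx (U : 'M[C]_d) :
  measurable_fun [set: borelCd R d] (mulmx U : borelCd R d -> borelCd R d).
Proof.
apply: (@measurability _ _ (borelCd R d) (borelCd R d) setT (mulmx U)
  (@open 'cV[C^o]_d)) => //.
move=> _ [A oA <-]; rewrite setTI; apply: sub_sigma_algebra.
by have /continuousP := @continuous_mulmx U; apply.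
Qed.

(** The squared modulus as a real number; the norm of [R[i]] takes values in [R[i]]. *)
Definition normsq (c : C) : R := complex.Re c ^+ 2 + complex.Im c ^+ 2.

Lemma normsqE (c : C) : (normsq c)%:C%C = `|c| ^+ 2.
Proof. by rewrite normc_def -rmorphXn sqr_sqrtr // addr_ge0 ?sqr_ge0. Qed.

Lemma measurable_linear_form_normsq (u : 'I_d -> C) : measurable_fun
  [set: borelCd R d]
  (fun z : borelCd R d => normsq (\sum_i u i * (z : 'cV[C]_d) i 0)).
Proof.
have mRe v : measurable_fun [set: borelCd R d]
    (fun z : borelCd R d => complex.Re (\sum_i v i * (z : 'cV[C]_d) i 0)).
  apply: (@measurable_continuous
    (fun z : 'cV[C]_d => complex.Re (\sum_i v i * z i 0))) => z.
  apply: (@continuous_comp _ C^o) (@continuous_linear_form v z) _.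
  exact: continuous_Re.
have ImE c : complex.Im c = complex.Re (- 'i%C * c :> C).
  by case: c => a b; rewrite /=; ring.
rewrite /normsq; apply: measurable_funD; apply: measurable_funX.
  exact: mRe.
under eq_fun do rewrite ImE mulr_sumr.
under eq_fun do under eq_bigr do rewrite mulrA.
exact: mRe.
Qed.

(* The power of the squared norm is 1 on the sphere; it is there to raise the
   bidegree from (k, k) to (j + k, j + k). *)
Definition power_moment (y : 'cV[C]_d) (j k : nat) (z : 'cV[C]_d) : R :=
  (\sum_i normsq (z i 0)) ^+ j * normsq (hdot y z) ^+ k.

Lemma measurable_power_moment y j k :
  measurable_fun [set: borelCd R d] (power_moment y j k : borelCd R d -> R).
Proof.
apply: measurable_funM; apply: measurable_funX.
  apply: measurable_sum => i.
  (* A coordinate is the linear form with Kronecker coefficients. *)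
  rewrite (_ : (fun _ => _) = fun z : borelCd R d =>
      normsq (\sum_l (l == i)%:R * (z : 'cV[C]_d) l 0)).
    exact: measurable_linear_form_normsq.
  apply/funext => z; rewrite (bigD1 i) //= eqxx mul1r big1 ?addr0 // => l li.
  by rewrite (negPf li) mul0r.
exact: measurable_linear_form_normsq.
Qed.

Lemma power_moment_ge0 y j k z : 0 <= power_moment y j k z.
Proof.
by rewrite mulr_ge0 ?exprn_ge0 ?addr_ge0 ?sqr_ge0 ?sumr_ge0 // => i _;
  rewrite addr_ge0 ?sqr_ge0.
Qed.

Lemma hdot_normsq (z : 'cV[C]_d) : hdot z z = (\sum_i normsq (z i 0))%:C%C.
Proof.
rewrite rmorph_sum; apply: eq_bigr => i _.
by rewrite /= normsqE normCK mulrC.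
Qed.

Lemma power_momentE y j k z :
  conj_eval (hmono y j k k) z = (power_moment y j k z)%:C%C.
Proof.
rewrite rmorphM !rmorphXn /= -hdot_normsq normsqE.
rewrite /conj_eval -[LHS]/(mpoly.meval (conj_point z) (hmono y j k k)).
by rewrite meval_hmono -exprMn normCK -hdotC.
Qed.

End Measurability.

(** * Unitary invariance of integrals over the sphere *)

Section Invariance.
Variables (R : realType) (d : nat) (omega : probability (borelCd R d) R).
Hypothesis omega_inv : unitarily_invariant_on_sphere omega.
Local Notation C := R[i].
Local Notation S := (sphere R d : set (borelCd R d)).

Lemma measurable_sphere : measurable S.
Proof.
(* [power_moment 0 1 0] is |z|^2. *)
have -> : S = (power_moment 0 1 0 : borelCd R d -> R) @^-1` [set 1].
  apply/seteqP; split => z; rewrite /sphere /= /power_moment herm_hdot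
    hdot_normsq expr1 mulr1; first by case.
  by move=> ->.
rewrite -[X in measurable X]setTI.
by apply: measurable_power_moment => //; exact: measurable_set1.
Qed.

(** Change of variables: omega is its own image under U, and U preserves the sphere. For f >= 0 no
    integrability has to be checked. *)
Lemma integral_unitary (U : 'M[C]_d) (f : borelCd R d -> R) :
    U \is unitarymx -> measurable_fun setT f -> (forall z, 0 <= f z) ->
  \int[omega]_(z in S) f (U *m (z : 'cV[C]_d)) = \int[omega]_(z in S) f z.
Proof.
move=> Uu mf f0; rewrite /Rintegral; congr fine.
have mU := @measurable_mulmx R d U.
rewrite -[RHS](@eq_measure_integral _ _ _ _ _
    (pushforward omega (mulmx U : borelCd R d -> borelCd R d))); last first.
  by move=> A mA _; have [_ inv] := omega_inv; exact: inv.
rewrite (ge0_integral_pushforward mU) //.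
- congr (integral _ _ _); apply/seteqP.
  by split=> z; rewrite /sphere /= !herm_hdot hdot_mulmx.
- exact: measurable_sphere.
- apply/measurable_EFinP; apply: measurable_funS mf => //.
- by move=> z _; rewrite lee_fin.
Qed.

Lemma sphere_integral_power_moment (y y' : 'cV[C]_d) j k :
    hdot y y = 1 -> hdot y' y' = 1 ->
  sphere_integral omega (conj_eval (hmono y j k k)) =
  sphere_integral omega (conj_eval (hmono y' j k k)).
Proof.
move=> y1 y'1.
have sphere_integralE x : sphere_integral omega (conj_eval (hmono x j k k)) =
    Complex (\int[omega]_(z in S) power_moment x j k z)
            (\int[omega]_(z in S) 0).
  by rewrite /sphere_integral; congr Complex; apply: eq_Rintegral => z _;
    rewrite power_momentE.
apply: etrans (sphere_integralE y) _.
apply: etrans _ (esym (sphere_integralE y')).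
apply: (congr1 (fun x => Complex x _)).
(* As U y = c y' with |c| = 1, the integrand for y' at U z is the integrand for y at z. *)
have [U [c [Uu c1 Uy]]] := unitary_transitive y1 y'1.
rewrite -[RHS](integral_unitary Uu); last 2 first.
- exact: measurable_power_moment.
- by move=> z; exact: power_moment_ge0.
apply: eq_Rintegral => z _; apply: complexI.
rewrite -!power_momentE /conj_eval.
rewrite -[LHS]/(mpoly.meval (conj_point z) (hmono y j k k)).
rewrite -[RHS]/(mpoly.meval (conj_point (U *m z)) (hmono y' j k k)).
rewrite !meval_hmono hdot_mulmx // -!exprMn.
rewrite (hdotC y z) (hdotC y') -!normCK; congr (_ * (_ ^+ 2) ^+ k).
by rewrite -(hdot_mulmx y z Uu) Uy hdotZl normrM norm_conjC c1 mul1r.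
Qed.

End Invariance.

(** * Moments of a design *)

Section Design.
Variables (R : realType) (d t : nat) (omega : probability (borelCd R d) R).
Variable X : {fset 'cV[R[i]]_d}.
Hypothesis d_gt0 : (0 < d)%N.
Hypothesis omega_inv : unitarily_invariant_on_sphere omega.
Hypothesis X_sphere : forall x, x \in X -> sphere R d x.
Hypothesis X_design : is_design omega t X.
Local Notation C := R[i].

Lemma Hom_hmono (y : 'cV[C]_d) (j k : nat) :
  Defs.Hom (j + k) (j + k) (conj_eval (hmono y j k k)).
Proof.
exists (hmono y j k k) => //.
by apply: all_bidegree; exact: bidegree_hmono.
Qed.

Lemma X_unit x : x \in X -> hdot x x = 1.
Proof. by move=> /X_sphere; rewrite /sphere /= herm_hdot. Qed.

(** The factor |z|^(2 (t - k)) brings the k-th moment into Hom(t, t) without changing it on X. *)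
Lemma design_power_moment (y : 'cV[C]_d) k : (k <= t)%N ->
  (#|` X|%:R)^-1 * moment X k y =
    sphere_integral omega (conj_eval (hmono y (t - k) k k)).
Proof.
move=> kt; rewrite -X_design; last first.
  by have := @Hom_hmono y (t - k) k; rewrite subnK.
congr (_ * _); apply: eq_big_seq => x xX.
rewrite power_momentE /power_moment rmorphM !rmorphXn /= -hdot_normsq normsqE.
by rewrite (X_unit xX) expr1n mul1r hdotC norm_conjC.
Qed.

(** For empty X the average is 0, as the inverse of 0 is 0, whereas |z|^(2 t) has integral 1 over
    the sphere. *)
Lemma design_neq0 : #|` X| != 0%N.
Proof.
apply/eqP => X0.
pose y : 'cV[C]_d := delta_mx (Ordinal d_gt0) 0.
have := @design_power_moment y 0 isT; rewrite X0 invr0 mul0r.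
rewrite /sphere_integral => /(congr1 (@complex.Re R)) /= /esym.
rewrite (eq_Rintegral _ (g := fun=> 1)); last first.
  move=> z; rewrite inE /sphere /= herm_hdot => z1.
  rewrite power_momentE /power_moment /= expr0 mulr1.
  have := hdot_normsq z; rewrite z1 => -[<-].
  by rewrite expr1n.
rewrite /Rintegral integral_cst; last exact: measurable_sphere.
have [omega1 _] := omega_inv.
rewrite mul1e => omega_eq0.
have omega_eq1 : fine (omega (sphere R d : set (borelCd R d))) = 1.
  by rewrite omega1.
by have /eqP := etrans (esym omega_eq1) omega_eq0; rewrite oner_eq0.
Qed.

Lemma design_moment_inv k (y y' : 'cV[C]_d) : (k <= t)%N ->
  hdot y y = 1 -> hdot y' y' = 1 -> moment X k y = moment X k y'.
Proof.
move=> kt y1 y'1; have N0 : (#|` X|%:R : C)^-1 != 0.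
  by rewrite invr_eq0 pnatr_eq0 design_neq0.
apply: (mulfI N0).
rewrite (@design_power_moment y k kt) (@design_power_moment y' k kt).
exact: sphere_integral_power_moment.
Qed.

Definition hpoly_sum r : R := \sum_(y <- X) \sum_(x <- X)
  normsq (hdot y x) * (hpoly R d r).[normsq (hdot y x)].

Lemma hpoly_sumE r : (hpoly_sum r)%:C%C = hsum X r.
Proof.
rewrite rmorph_sum; apply: eq_bigr => y _; rewrite rmorph_sum.
apply: eq_bigr => x _; rewrite /= -normsqE; move: (normsq _) => a.
rewrite /hpoly hornerZ horner_sum mulrCA !mulr_sumr rmorph_sum.
apply: eq_bigr => j _.
rewrite hornerZ hornerXn /= exprS /hcoef.
rewrite !(rmorphM, rmorphXn, fmorphV, rmorph_nat, rmorphN1) /=; ring.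
Qed.
End Design.

(** * The two estimates of the sum of a F(a) over pairs *)

Theorem theorem3p5p10 (R : realType) (d t : nat)
    (omega : probability (borelCd R d) R)
    (X : {fset 'cV[R[i]]_d}) (F : {poly R}) (c : seq R)
    (d_gt0 : (0 < d)%N)
    (omega_inv : unitarily_invariant_on_sphere omega)
    (X_sphere : forall x, x \in X -> sphere R d x)
    (X_lines : forall x y, x \in X -> y \in X -> x != y ->
       <[x]>%VS != <[y]>%VS)
    (t_ge1 : (1 <= t)%N)
    (X_design : is_design omega t X)
    (F_degree_set : forall a, degree_set X a -> 0 <= a * F.[a])
    (F1_gt0 : 0 < F.[1])
    (F_expansion : F = \sum_(r < size c) c`_r *: hpoly R d r)
    (c0_gt0 : 0 < c`_0)
    (c_le0 : forall r, (t <= r)%N -> c`_r <= 0) :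
  F.[1] / c`_0 <= #|` X|%:R.
Proof.
have X1 := @X_unit _ _ _ X_sphere.
have moment_inv := design_moment_inv d_gt0 omega_inv X_sphere X_design.
have N_gt0 : 0 < #|` X|%:R :> R.
  by rewrite ltr0n lt0n (design_neq0 d_gt0 omega_inv X_sphere X_design).
pose a (x y : 'cV[R[i]]_d) : R := normsq (hdot y x).
have lower : #|` X|%:R * F.[1] <= \sum_(y <- X) \sum_(x <- X) a x y * F.[a x y].
  have -> : #|` X|%:R * F.[1] = \sum_(y <- X) F.[1].
    by rewrite big_const_seq count_predT iter_addr_0 mulr_natl.
  rewrite big_seq [leRHS]big_seq; apply: ler_sum => y yX.
  have ayy : a y y = 1.
    by apply: complexI; rewrite /a normsqE X1 // normr1 expr1n.
  (* The diagonal term is F(1); the others are nonnegative by the condition on the degree set. *)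
  rewrite (bigD1_seq y) //= ayy mul1r lerDl big_seq_cond.
  apply: sumr_ge0 => x /andP[xX xy]; apply: F_degree_set.
  by exists y, x; split; rewrite // 1?eq_sym // herm_hdot -normsqE.
have upper :
    \sum_(y <- X) \sum_(x <- X) a x y * F.[a x y] <= c`_0 * #|` X|%:R ^+ 2.
  have -> : \sum_(y <- X) \sum_(x <- X) a x y * F.[a x y] =
      \sum_(r < size c) c`_r * hpoly_sum X r.
    under [RHS]eq_bigr do rewrite mulr_sumr.
    rewrite [RHS]exchange_big; apply: eq_bigr => y _ /=.
    under [RHS]eq_bigr do rewrite mulr_sumr.
    rewrite [RHS]exchange_big; apply: eq_bigr => x _ /=.
    rewrite F_expansion horner_sum mulr_sumr; apply: eq_bigr => r _.
    by rewrite hornerZ mulrCA.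
  have sum0 : hpoly_sum X 0 = #|` X|%:R ^+ 2.
    by apply: complexI; rewrite hpoly_sumE (hsum0 d_gt0 X1 moment_inv) //
      rmorphXn /= rmorph_nat.
  have sum_eq0 r : (0 < r < t)%N -> hpoly_sum X r = 0.
    move=> rt; apply: complexI.
    by rewrite hpoly_sumE (hsum_eq0 d_gt0 X1 moment_inv).
  have sum_ge0 r : 0 <= hpoly_sum X r.
    by rewrite -lecR hpoly_sumE; exact: hsum_ge0.
  (* For empty c the default value c_0 = 0 contradicts c_0 > 0, so the term r = 0 can be split
     off. *)
  case: (c) c0_gt0 c_le0 => [|c0 c']; first by rewrite ltxx.
  move=> _ cle0; rewrite big_ord_recl sum0 gerDl; apply: sumr_le0 => i _.
  (* Below t the sum S_r is 0; from t on, c_r <= 0 <= S_r. *)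
  have [it|ti] := ltnP (lift ord0 i) t; first by rewrite sum_eq0 ?mulr0.
  by rewrite mulr_le0_ge0 ?cle0.
(* One factor |X| > 0 cancels from |X| F(1) <= c_0 |X|^2. *)
rewrite ler_pdivrMr // -(ler_pM2l N_gt0).
rewrite (le_trans lower) // (le_trans upper) //.
by rewrite [leRHS]mulrA -expr2 [leRHS]mulrC.
Qed.
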